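(* Let $w_1,\dots,w_n$ be positive real numbers and let $H_{\mathfrak W}=\prod_{k=1}^n\{0,w_k\}\subseteq\mathbb R^n$, equipped with the $\ell^1$ metric. Suppose that $X=\{\boldsymbol x_0=\boldsymbol 0,\boldsymbol x_1,\dots,\boldsymbol x_n\}$ is an $(n+1)$-point subset of $H_{\mathfrak W}$. Then $$\mathrm{cof}(D_X)=(-1)^n\,2^n\Bigl(\prod_{k=1}^n w_k\Bigr)\det(\hat B)^2 .$$
   Context: $D_X=(\|\boldsymbol x_i-\boldsymbol x_j\|_1)_{i,j=0}^n$ is the distance matrix of $X$. For a square matrix $A$, the cofactor sum is $\mathrm{cof}(A)=\sum_{i,j}(-1)^{i+j}\det(A_{i|j})$, where $A_{i|j}$ is obtained from $A$ by deleting the $i$th row and $j$th column. With $W=\mathrm{diag}(w_1,\dots,w_n)$, $\hat B$ is the $n\times n$ matrix whose $i$th row is $\hat{\boldsymbol x}_i=W^{-1}\boldsymbol x_i\in\{0,1\}^n$, $1\le i\le n$. *)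

(* Defs.v *)
From HB Require Import structures.
From mathcomp Require Import all_boot all_order all_algebra.
From mathcomp Require Import reals.

Set Implicit Arguments.
Unset Strict Implicit.
Unset Printing Implicit Defensive.

Import Order.TTheory GRing.Theory Num.Theory.

Local Open Scope ring_scope.

Definition weighted_cube (R : realType) (n : nat) (w : 'rV[R]_n)
  : pred 'cV[R]_n :=
  [pred v : 'cV[R]_n | [forall k, (v k 0 == 0) || (v k 0 == w 0 k)]].

Definition l1_dist (R : realType) (n : nat) (u v : 'cV[R]_n) : R :=
  \sum_k `|u k 0 - v k 0|.

Definition distance_matrix (R : realType) (m n : nat)
  (x : 'I_m -> 'cV[R]_n) : 'M[R]_m :=
  \matrix_(i, j) l1_dist (x i) (x j).

(* [cofactor A i j] already carries the sign (-1)^(i+j). *)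
Definition cofactor_sum (R : realType) (m : nat) (A : 'M[R]_m) : R :=
  \sum_i \sum_j cofactor A i j.

Definition rescale (R : realType) (n : nat) (w : 'rV[R]_n)
  (v : 'cV[R]_n) : 'cV[R]_n :=
  invmx (diag_mx w) *m v.

(* Rows are indexed from 0: row [i : 'I_n] comes from the point of index
   [lift ord0 i], i.e. i + 1, so the base point x ord0 is left out. *)
Definition Bhat (R : realType) (n : nat) (w : 'rV[R]_n)
  (x : 'I_n.+1 -> 'cV[R]_n) : 'M[R]_n :=
  \matrix_(i < n) (rescale w (x (lift ord0 i)))^T.

(* Main.v *)
Require Import Defs.
From HB Require Import structures.
From mathcomp Require Import all_boot all_order all_algebra.
From mathcomp Require Import reals.
From mathcomp Require Import ring.

Set Implicit Arguments.
Unset Strict Implicit.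
Unset Printing Implicit Defensive.

Import Order.TTheory GRing.Theory Num.Theory.

Local Open Scope ring_scope.

(** On the two-point set {0, w} the distance is a quadratic polynomial: for
    a, b in {0, 1} one has |w a - w b| = w (a + b - 2 a b).  Writing B for the
    matrix of all rescaled points (row 0 included) and r for the vector of
    distances to the base point 0, summation over the coordinates yields
      D = r 1^T + 1 r^T - 2 B W B^T.
    The cofactor sum does not see the two rank-one terms
    ([cofactor_sum_rank1D]): up to sign it is the determinant of the matrix
    bordered by ones ([det_border]), and those terms are undone by adding
    multiples of the border to the other rows and columns.  So the cofactor sum
    of D is that of the weighted Gram matrix G = - 2 B W B^T.  Since the base
    point is 0, row 0 and column 0 of G vanish, hence the only surviving
    cofactor is the one at (0, 0) ([cofactor_sum_zero_border]), namely
      det (- 2 Bhat W Bhat^T) = (-2)^n (\prod_k w_k) det(Bhat)^2. *)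

(** Laplace expansion along the row v and then along the column u.  The minus
    sign arises because the border shifts the column index of v by one, while
    the column u is the first one of the remaining minor. *)
Lemma det_border (R : comNzRingType) (m : nat) (u : 'cV[R]_m.+1)
    (v : 'rV[R]_m.+1) (A : 'M[R]_m.+1) :
  \det (block_mx (0 : 'M_1) v u A) =
    - \sum_i \sum_j u i 0 * v 0 j * cofactor A i j.
Proof.
rewrite (expand_det_row _ (lshift _ ord0)) big_split_ord /= big_ord1.
rewrite block_mxEul mxE mul0r add0r exchange_big -sumrN; apply: eq_bigr => j _.
rewrite block_mxEur /cofactor (expand_det_col _ ord0) mulr_sumr mulr_sumr -sumrN.
apply: eq_bigr => i _.
have -> : row' (lshift m.+1 (ord0 : 'I_1))
    (col' (rshift 1 j) (block_mx (0 : 'M_1) v u A)) i ord0 = u i 0.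
  rewrite !mxE.
  have -> : lift (lshift m.+1 (ord0 : 'I_1)) i = rshift 1 i by apply: val_inj.
  have -> : lift (rshift 1 j) ord0 = lshift m.+1 (ord0 : 'I_1) by apply: val_inj.
  by rewrite (unsplitK (inr i)) mxE (unsplitK (inl ord0)).
rewrite /cofactor.
have -> : row' i (col' ord0 (row' (lshift m.+1 (ord0 : 'I_1))
    (col' (rshift 1 j) (block_mx (0 : 'M_1) v u A)))) = row' i (col' j A).
  apply/matrixP => k l; rewrite !mxE.
  have -> : lift (lshift m.+1 (ord0 : 'I_1)) (lift i k) = rshift 1 (lift i k).
    exact: val_inj.
  have -> : lift (rshift 1 j) (lift ord0 l) = rshift 1 (lift j l).
    by apply: val_inj; rewrite /= /bump /= !add1n ltnS addnS.
  by rewrite (unsplitK (inr _)) mxE (unsplitK (inr _)).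
by rewrite /= addn0 add0n !exprD expr1; ring.
Qed.

Lemma cofactor_sum_border (R : realType) (m : nat) (A : 'M[R]_m.+1) :
  cofactor_sum A =
    - \det (block_mx (0 : 'M_1) (const_mx 1) (const_mx 1) A).
Proof.
rewrite det_border opprK; apply: eq_bigr => i _; apply: eq_bigr => j _.
by rewrite !mxE !mul1r.
Qed.

(** After bordering with ones, adding the two rank-one matrices amounts to
    multiplying by unitriangular matrices on both sides. *)
Lemma cofactor_sum_rank1D (R : realType) (m : nat) (A : 'M[R]_m.+1)
    (r c : 'I_m.+1 -> R) :
  cofactor_sum (\matrix_(i, j) (r i + c j + A i j)) = cofactor_sum A.
Proof.
rewrite !cofactor_sum_border; congr (- _).
have -> : block_mx (0 : 'M_1) (const_mx 1) (const_mx 1)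
    (\matrix_(i, j) (r i + c j + A i j)) =
  block_mx 1%:M 0 (\col_i r i) 1%:M *m
  block_mx (0 : 'M_1) (const_mx 1) (const_mx 1) A *m
  block_mx 1%:M (\row_j c j) 0 1%:M.
  rewrite !mulmx_block !(mul0mx, mulmx0, mul1mx, mulmx1, addr0, add0r).
  congr block_mx; apply/matrixP => i j.
  by rewrite !mxE !big_ord1 !mxE; ring.
by rewrite !det_mulmx det_lblock det_ublock !det1 !(mul1r, mulr1).
Qed.

(** Every cofactor other than the one at (0, 0) retains a zero row or a zero
    column. *)
Lemma cofactor_sum_zero_border (R : realType) (m : nat) (A : 'M[R]_m.+1)
    (A0r : forall j, A ord0 j = 0) (A0c : forall i, A i ord0 = 0) :
  cofactor_sum A = \det (row' ord0 (col' ord0 A)).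
Proof.
case: m A A0r A0c => [|m] A A0r A0c.
  by rewrite /cofactor_sum !big_ord1 /cofactor mul1r.
have lift0 (h : 'I_m.+2) : h != ord0 -> lift h ord0 = ord0 :> 'I_m.+2.
  by rewrite -lt0n => h0; apply: val_inj; rewrite /= /bump leqNgt h0.
rewrite /cofactor_sum (bigD1 ord0) //= (bigD1 ord0) //=.
rewrite [X in _ + X + _]big1 ?[X in _ + X]big1 ?addr0.
- by rewrite /cofactor mul1r.
- move=> i i0; apply: big1 => j _; rewrite /cofactor (expand_det_row _ ord0).
  by rewrite big1 ?mulr0 // => k _; rewrite !mxE lift0 // A0r mul0r.
- move=> j j0; rewrite /cofactor (expand_det_col _ ord0).
  by rewrite big1 ?mulr0 // => k _; rewrite !mxE lift0 // A0c mul0r.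
Qed.

Lemma rescaleK (R : realType) (n : nat) (w : 'rV[R]_n)
    (w_neq0 : forall k, w 0 k != 0) (v : 'cV[R]_n) (k : 'I_n) :
  v k 0 = w 0 k * rescale w v k 0.
Proof.
have w_unit : diag_mx w \in unitmx.
  by rewrite unitmxE det_diag unitfE; apply/prodf_neq0.
by rewrite -{1}(mulKVmx w_unit v) mul_diag_mx mxE.
Qed.

(** The absolute value becomes a bilinear expression plus one term in u alone
    and one in v alone, because a rescaled coordinate is 0 or 1 and so equals
    its own square. *)
Lemma l1_dist_cube (R : realType) (n : nat) (w : 'rV[R]_n)
    (w_pos : forall k : 'I_n, 0 < w 0 k) (u v : 'cV[R]_n)
    (u_cube : u \in weighted_cube w) (v_cube : v \in weighted_cube w) :
  l1_dist u v = \sum_k u k 0 + \sum_k v k 0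
    - 2 * \sum_k rescale w u k 0 * w 0 k * rescale w v k 0.
Proof.
have w_neq0 k : w 0 k != 0 by rewrite gt_eqF.
rewrite mulr_sumr -sumrN -!big_split; apply: eq_bigr => k _ /=.
have bit (z : 'cV[R]_n) : z \in weighted_cube w ->
    rescale w z k 0 = 0 \/ rescale w z k 0 = 1.
  rewrite inE => /forallP/(_ k); rewrite (rescaleK w_neq0 z) mulf_eq0.
  rewrite (negPf (w_neq0 k)) /= => /orP[/eqP -> | /eqP e]; [by left | right].
  by apply: (mulfI (w_neq0 k)); rewrite mulr1.
rewrite (rescaleK w_neq0 u) (rescaleK w_neq0 v).
have w_abs : `|w 0 k| = w 0 k by rewrite gtr0_norm.
case: (bit u u_cube) => ->; case: (bit v v_cube) => ->;
  rewrite !(mulr0, mulr1, mul0r, mul1r) ?subrr ?subr0 ?sub0r ?normrN ?normr0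
    ?w_abs; ring.
Qed.

Theorem corollary5p6 (R : realType) (n : nat) (w : 'rV[R]_n)
    (w_pos : forall k : 'I_n, 0 < w 0 k)
    (x : 'I_n.+1 -> 'cV[R]_n)
    (x_inj : injective x)
    (x_cube : forall i : 'I_n.+1, x i \in weighted_cube w)
    (x_base : x ord0 = 0) :
  cofactor_sum (distance_matrix x) =
    (-1) ^+ n * 2 ^+ n * (\prod_(k < n) w 0 k) * (\det (Bhat w x)) ^+ 2.
Proof.
pose G : 'M[R]_n.+1 := \matrix_(i, j)
  (- (2 * \sum_k rescale w (x i) k 0 * w 0 k * rescale w (x j) k 0)).
have -> : distance_matrix x =
    \matrix_(i, j) (\sum_k x i k 0 + \sum_k x j k 0 + G i j).
  by apply/matrixP => i j; rewrite !mxE (l1_dist_cube w_pos).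
have b0 k : rescale w (x ord0) k 0 = 0 by rewrite x_base /rescale mulmx0 mxE.
rewrite (cofactor_sum_rank1D G) cofactor_sum_zero_border; first last.
- by move=> i; rewrite mxE big1 ?mulr0 ?oppr0 // => k _; rewrite b0 mulr0.
- by move=> j; rewrite mxE big1 ?mulr0 ?oppr0 // => k _; rewrite b0 !mul0r.
have -> : row' ord0 (col' ord0 G) =
    (-1 * 2) *: (Bhat w x *m diag_mx w *m (Bhat w x)^T).
  apply/matrixP => i j; rewrite !mxE mulN1r mulNr; congr (- (_ * _)).
  by apply: eq_bigr => k _; rewrite mul_mx_diag !mxE.
by rewrite detZ !det_mulmx det_tr det_diag exprMn; ring.
Qed.
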